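(* Cap-free graphs have the $\mathcal{O}(n^5)$-CS-Separation property: there is a constant $A$ such that every cap-free graph $G$ on $n$ vertices admits a CS-Separator of size at most $A n^5$.
   Context: A cut of $G$ is a partition $(W,W')$ of $V(G)$; it separates disjoint $K,S$ if $K\subseteq W$, $S\subseteq W'$. A CS-Separator of $G$ is a family of cuts such that every clique $K$ and stable set $S$ of $G$ with $K\cap S=\emptyset$ are separated by some cut; its size is the number of cuts. A hole is a chordless cycle of length at least $4$. A cap is a hole together with an additional vertex adjacent to exactly two consecutive vertices of the hole (and to no other vertex of the hole). A graph is cap-free if it contains no cap as an induced subgraph. *)

(* Defs.v *)
From mathcomp Require Import all_boot.

Set Implicit Arguments.
Unset Strict Implicit.
Unset Printing Implicit Defensive.

(* A finite simple graph is a finType of vertices with a symmetric and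
   irreflexive adjacency relation e. *)

Definition simple_graph (T : finType) (e : rel T) : Prop :=
  symmetric e /\ irreflexive e.

Definition clique (T : finType) (e : rel T) (K : {set T}) : Prop :=
  {in K &, forall x y, x != y -> e x y}.

Definition stable_set (T : finType) (e : rel T) (S : {set T}) : Prop :=
  {in S &, forall x y, ~~ e x y}.

(* Cuts are ordered pairs, and either side may be empty: a separator has to
   handle the pairs K = V, S = set0 when V is a clique. *)
Definition is_cut (T : finType) (W : {set T} * {set T}) : Prop :=
  W.1 :&: W.2 = set0 /\ W.1 :|: W.2 = [set: T].

Definition separates (T : finType) (W : {set T} * {set T}) (K S : {set T}) :
  Prop := K \subset W.1 /\ S \subset W.2.

Definition CS_separator (T : finType) (e : rel T)
    (F : {set {set T} * {set T}}) : Prop :=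
  (forall W, W \in F -> is_cut W) /\
  (forall K S : {set T}, clique e K -> stable_set e S -> K :&: S = set0 ->
     exists2 W, W \in F & separates W K S).

Definition induced (T : finType) (e : rel T) (X : {set T}) :
  rel {x : T | x \in X} := fun x y => e (val x) (val y).

(* The vertices of the hole are listed in cyclic order. *)
Definition hole (T : finType) (e : rel T) (c : seq T) : Prop :=
  [/\ ucycle e c, 4 <= size c &
      {in c &, forall x y, e x y -> y = next c x \/ x = next c y}].

(* The whole graph e is a cap: its vertices are those of a hole c together
   with v, whose neighbours on c are the consecutive vertices x, next c x. *)
Definition is_cap (T : finType) (e : rel T) : Prop :=
  exists (c : seq T) (v : T),
    [/\ hole e c, v \notin c, (forall y, y \in v :: c) &
        exists2 x, x \in c &
          {in c, forall y, e v y <-> y = x \/ y = next c x}].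

Definition cap_free (T : finType) (e : rel T) : Prop :=
  forall X : {set T}, ~ is_cap (@induced T e X).

(* Main.v *)
Require Import Defs.
From mathcomp Require Import all_boot.
From mathcomp Require Import zify.

Set Implicit Arguments.
Unset Strict Implicit.
Unset Printing Implicit Defensive.

(* Let Phi(V) be the number of nonadjacent pairs in V. By induction on |V|, V is
   separated by O(n^2 Phi(V)) cuts, hence T by O(n^4).
   If V is not a clique, let v, w be nonadjacent with the component Q of w in
   V \ N[v] as large as possible, B = N(Q) and L = V \ (Q u B). Then L is
   complete to B. A clique meeting L lies in L u B, and cap-freeness gives a
   vertex q of Q complete to its part in B. So the separators of L and B u Q
   only need O(n^2) extra cuts, unless some nonadjacent pair (v, q) is complete
   to k, k', s with k, k' adjacent and s adjacent to neither.
   In that case, a maximal join (X, Y), with k, k', s in X, yields an amalgam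
   around the component E of k in X: V splits into two smaller sets that share
   only a clique, and their separators extend to V without any extra cut. *)

(** * Caps, and common neighbours on paths *)

(** [cap_free] speaks of subtypes of [T]. Lifting [c] and [v] to the subtype of the vertices of
    [v :: c] turns a cap drawn inside [T] into a forbidden one, so that later arguments can stay in
    [T]. *)
Lemma cap_free_hole (T : finType) (e : rel T) (c : seq T) (v x : T) :
  cap_free e -> hole e c -> v \notin c -> x \in c ->
  {in c, forall y, e v y <-> y = x \/ y = next c x} -> False.
Proof.
move=> capF holec vc xc vP.
pose X := [set y in v :: c].
have cX y : y \in v :: c -> y \in X by move=> yc; rewrite in_set.
pose lift := fun y : T => insubd (exist _ v (cX v (mem_head v c)) : {x : T | x \in X}) y.
have liftK y : y \in v :: c -> val (lift y) = y.
  by move=> yc; rewrite /lift insubdK //; exact: (cX y yc).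
pose c' := map lift c.
have c'K : map val c' = c.
  rewrite -map_comp -[RHS]map_id; apply/eq_in_map => y yc /=.
  by rewrite liftK // inE yc orbT.
have nextE y : val (next c' y) = next c (val y).
  rewrite -[in RHS]c'K next_map //; first exact: val_inj.
  rewrite -(map_inj_uniq val_inj) c'K.
  by case: holec => /andP[].
have memE y : (y \in c') = (val y \in c).
  by rewrite -[in RHS]c'K mem_map //; exact: val_inj.
apply: (capF X); exists c', (lift v); case: holec => /andP[cyc uc] sz ch.
have lv : val (lift v) = v by rewrite liftK // mem_head.
split.
- split.
  + apply/andP; split; last by rewrite -(map_inj_uniq val_inj) c'K.
    by rewrite -c'K cycle_map in cyc.
  + by rewrite size_map.
  + move=> y z; rewrite !memE => yc zc eyz.
    by case: (ch _ _ yc zc eyz) => E; [left|right]; apply: val_inj; rewrite nextE.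
- by rewrite memE lv.
- by move=> y; rewrite inE memE -val_eqE lv; have := valP y; rewrite !inE.
- exists (lift x); first by rewrite memE liftK // inE xc orbT.
  move=> y; rewrite memE => yc; rewrite /induced lv.
  have lx : val (lift x) = x by rewrite liftK // inE xc orbT.
  split.
    by move/(vP _ yc) => [] E; [left|right]; apply: val_inj; rewrite ?nextE lx.
  by move=> E; apply/(vP _ yc); case: E => ->; [left|right]; rewrite ?nextE lx.
Qed.

Section CapFree.

Variables (T : finType) (e : rel T).
Hypotheses (esym : symmetric e) (eirr : irreflexive e) (capF : cap_free e).
Implicit Types (a h t x y z : T) (p q s : seq T).

(* Otherwise a shortest path makes a, p, h a hole, and t completes it to a cap. *)
Lemma common_neighbour a h t p :
    e a h -> e t a -> e t h -> path e a (rcons p h) -> p != [::] ->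
    {in p, forall z, ~~ e t z} ->
  exists2 z, z \in p & e a z && e z h.
Proof.
move=> eah eta eth.
have [n] := ubnP (size p); elim: n p => // n IHn p0 /ltnSE sz0.
rewrite rcons_path => /andP[pth0 lst0] p0n tp0.
(* [t] sees [a] but not the last vertex of [p0]; hence the shortened path is not empty. *)
have lst_a : last a p0 != a.
  case/lastP: p0 p0n tp0 {sz0 pth0 lst0} => // p z _ tp; rewrite last_rcons.
  by apply: contraL (tp z _) => [/eqP->|]; rewrite ?negbK // mem_rcons mem_head.
case: (shortenP pth0) lst0 lst_a => p pth up sub lst lst_a.
have tp : {in p, forall z, ~~ e t z} by move=> z /sub; apply: tp0.
have szp : size p <= n.
  apply: leq_trans sz0; apply: uniq_leq_size => //.
  by case/andP: up.
suff [z zp zz] : exists2 z, z \in p & e a z && e z h by exists z => //; apply: sub.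
case: (boolP (has (fun z => e a z && e z h) p)) => [/hasP[z zp zz]|nocn].
  by exists z.
exfalso; move: {p0 pth0 p0n tp0 sub sz0} IHn => IHn.
have pn : p != [::] by apply: contraNneq lst_a => ->.
pose s := rcons p h; pose c := a :: s.
have szs : size s = (size p).+1 by rewrite size_rcons.
have pths : path e a s by rewrite rcons_path pth lst.
have hc : h \notin a :: p.
  rewrite inE negb_or; apply/andP; split.
    by apply: contraTneq eah => ->; rewrite eirr.
  by apply/negP => /tp; rewrite eth.
have uc : uniq c by rewrite /c -rcons_cons rcons_uniq hc.
(* The vertices of [c] are numbered from [a] at 0 to [h] at [size s]. A chord shortcuts the path,
   and the induction hypothesis then yields the common neighbour excluded by [nocn]. *)
have chord i j : i < j <= size s -> e (nth a c i) (nth a c j) ->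
    j = i.+1 \/ i = 0 /\ j = size s.
  move=> /andP[ij js] eij; have [->|jni] := eqVneq j i.+1; first by left.
  have [|ends] := boolP ((i == 0) && (j == size s)).
    by move=> /andP[/eqP-> /eqP->]; right.
  exfalso; case: j => // j in ij js eij jni ends *.
  rewrite eqSS in jni.
  have lt_ij : i < j by rewrite ltn_neqAle eq_sym jni.
  have le_jp : j <= size p by rewrite szs ltnS in js.
  (* The index [j] has been decremented: the chord joins positions [i] and [j.+1], and [p'] omits
     the vertices strictly between them. For [j = size p] the chord ends at [h]. *)
  pose p' := take i p ++ drop j p.
  have p's : rcons p' h = take i s ++ drop j s.
    rewrite /p' /s -!cats1 -catA takel_cat ?drop_cat; last first.
      by apply: leq_trans le_jp; apply: ltnW.
    by case: ltngtP le_jp => // -> _; rewrite subnn drop0 drop_size.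
  have pthp' : path e a (rcons p' h).
    rewrite p's cat_path; move: (pths); rewrite -{1}(cat_take_drop i s).
    rewrite cat_path => /andP[-> _] /=.
    move: (pths); rewrite -{1}(cat_take_drop j s) cat_path => /andP[_].
    rewrite (drop_nth a js) /= => /andP[_ ->]; rewrite andbT.
    suff -> : last a (take i s) = nth a c i by [].
    rewrite (last_nth a) size_takel; last first.
      by apply: leq_trans (ltnW js); apply: ltnW.
    by case: i {eij ends p's p' jni ij} lt_ij => //= i lij; rewrite nth_take.
  have [|||z zp' zz] := IHn p' _ pthp'.
  - rewrite size_cat size_takel ?size_drop; last exact: leq_trans (ltnW lt_ij) le_jp.
    by apply: leq_trans szp; rewrite -{2}(subnKC le_jp) ltn_add2r.
  - apply: contraNneq ends => p'n; move: (congr1 size p'n).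
    rewrite size_cat size_takel ?size_drop; last exact: leq_trans (ltnW lt_ij) le_jp.
    move/eqP; rewrite addn_eq0 => /andP[-> ]; rewrite subn_eq0 => le_pj.
    by rewrite szs eqSS eqn_leq le_jp le_pj.
  - by move=> z; rewrite mem_cat => /orP[/mem_take|/mem_drop]; apply: tp.
  - move/hasPn: nocn => /(_ z); rewrite zz => /(_ _)/negP[] //.
    by move: zp'; rewrite mem_cat => /orP[/mem_take|/mem_drop].
have nextE i : i <= size s -> next c (nth a c i) = nth a s i.
  by move=> le_is; rewrite next_nth mem_nth ?ltnS // index_uniq.
have nthh : nth a c (size s) = h by rewrite szs /c /s /= nth_rcons ltnn eqxx.
have tc : t \notin c.
  rewrite inE mem_rcons inE !negb_or; apply/and3P; split.
  - by apply: contraTneq eta => ->; rewrite eirr.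
  - by apply: contraTneq eth => ->; rewrite eirr.
  - by apply: contra nocn => tp1; apply/hasP; exists t => //; rewrite esym eta.
have nexth : next c h = a by rewrite -nthh nextE // nth_default.
(* The hole is traversed as [a], [p], [h], so the edge seen by [t] runs from [h] to
   [next c h = a]. *)
apply: (cap_free_hole capF (c := c) (v := t) (x := h)) => //.
- split.
  + apply/andP; split => //; rewrite /c /= rcons_path pths /=.
    by rewrite /s last_rcons esym.
  (* If [p] had a single vertex, that vertex would be a common neighbour; so the cycle has length at
     least 4. *)
  + rewrite /c /= szs; case: p pn nocn pth lst {szp lst_a up tp s c szs pths hc uc chord nextE nthh tc nexth} => // z [|z' p] // _.
    by rewrite /= !orbF andbT => /negP nz eaz ezh; case: nz; rewrite eaz.
  + suff W i j : i < j <= size s -> e (nth a c i) (nth a c j) ->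
        nth a c j = next c (nth a c i) \/ nth a c i = next c (nth a c j).
      move=> x y /(nthP a)[i si <-] /(nthP a)[j sj <-] exy.
      rewrite /= ltnS in si sj; case: (ltngtP i j) => [lij|lji|eij].
      * by apply: W exy; rewrite lij.
      * by rewrite esym in exy; apply/or_comm/W => //; rewrite lji.
      * by rewrite eij eirr in exy.
    move=> ij eij; case: (chord _ _ ij eij) => [E|[-> ->]].
      by left; subst j; rewrite nextE //; case/andP: ij => _ /ltnW.
    by right; rewrite -/c nthh nexth.
- by rewrite /c inE mem_rcons mem_head orbT.
- move=> y; rewrite inE mem_rcons inE nexth => yc; split; last by case=> ->.
  move: yc => /or3P[/eqP->|/eqP->|yp]; [by right|by left|].
  by rewrite (negPf (tp _ yp)).
Qed.

End CapFree.

(** * Separators of a vertex set, and amalgams *)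

(** A cut is recorded by its clique side [W] alone, which may reach outside [V]; so the separators
    of all subsets of [T] are families of the same type. *)
Definition separator (T : finType) (e : rel T) (V : {set T})
    (F : {set {set T}}) : Prop :=
  forall K S : {set T}, K \subset V -> S \subset V ->
    clique e K -> stable_set e S -> [disjoint K & S] ->
    exists2 W, W \in F & (K \subset W) && [disjoint S & W].

Definition separable (T : finType) (e : rel T) (V : {set T}) (n : nat) : Prop :=
  exists2 F : {set {set T}}, separator e V F & #|F| <= n.

Section Separable.

Variables (T : finType) (e : rel T).
Hypotheses (esym : symmetric e) (eirr : irreflexive e).
Implicit Types (x y z : T) (V K S W : {set T}).

(** A stable set inside a clique has at most one vertex, so it is enough to cut off nothing or a
    single vertex. *)
Lemma separable_clique V : clique e V -> separable e V #|V|.+1.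
Proof.
move=> clV; exists (V |: [set V :\ x | x in V]); last first.
  by apply: leq_trans (leq_card_setU _ _) _; rewrite cards1 add1n ltnS leq_imset_card.
move=> K S KV SV _ stS dKS.
have [->|[x xS]] := set_0Vmem S.
  by exists V; rewrite ?setU11 // KV -setI_eq0 set0I eqxx.
exists (V :\ x).
  by apply/setU1P; right; apply/imsetP; exists x => //; apply: (subsetP SV).
rewrite subsetD1 KV (disjointFl dKS xS) /= disjoint_subset.
apply/subsetP => z zS; rewrite !inE negb_and negbK; apply/orP; left.
apply/negPn/negP => zx; move: (stS _ _ zS xS).
by rewrite (clV _ _ (subsetP SV _ zS) (subsetP SV _ xS) zx).
Qed.

Definition complete (X Y : {set T}) : Prop := {in X & Y, forall x y, e x y}.
Definition anticomplete (X Y : {set T}) : Prop := {in X & Y, forall x y, ~~ e x y}.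

(* V = E + A1 + C + B2 + A2 is an amalgam with clique C, except that C need be
   complete to only one vertex y of B2. The markers y and x stand for B2 and E in
   the two parts. A cut of the first part sends B2 to the side of y, but never
   together with the clique when it leaves some vertex of C on the stable side. *)
Lemma separable_amalgam (V E A1 C B2 A2 : {set T}) x y n1 n2 :
    V \subset (E :|: A1 :|: C) :|: (B2 :|: A2) ->
    x \in E -> y \in B2 -> [disjoint E & A2] -> [disjoint A1 & B2] ->
    clique e C -> complete E C -> {in C, forall c, e c y} ->
    complete E B2 -> anticomplete E A2 -> anticomplete A1 B2 -> anticomplete A1 A2 ->
    separable e (y |: (E :|: A1 :|: C)) n1 ->
    separable e (x |: (B2 :|: A2 :|: C)) n2 -> separable e V (n1 + n2).
Proof.
move=> covV xE yB2 dEA2 dAB clC cEC cCy cEB aEA aAB aAA [F1 sep1 le1] [F2 sep2 le2].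
set V1 := E :|: A1 :|: C in covV sep1; set V2 := B2 :|: A2 :|: C in sep2.
(* [ext1] leaves all vertices outside [V1] and [B2] on the stable side, [ext2] all those outside
   [V2] and [E]; the part to use depends on where [K] and [S] lie. *)
pose ext1 W := (W :&: V1) :|: (if (y \in W) && (C \subset W) then B2 else set0).
pose ext2 W := (W :&: V2) :|: (if x \in W then E else set0).
have in_ext1 W z : (z \in ext1 W) =
    (z \in W) && (z \in V1) || [&& z \in B2, y \in W & C \subset W].
  by rewrite /ext1 !inE; case: ifP; rewrite ?inE ?andbT ?andbF.
have in_ext2 W z : (z \in ext2 W) =
    (z \in W) && (z \in V2) || [&& z \in E & x \in W].
  by rewrite /ext2 !inE; case: ifP; rewrite ?inE ?andbT ?andbF.
exists (ext1 @: F1 :|: ext2 @: F2); last first.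
  apply: leq_trans (leq_card_setU _ _) _.
  by apply: leq_add; [apply: leq_trans le1|apply: leq_trans le2]; apply: leq_imset_card.
have use1 K S K' S' : K' \subset y |: V1 -> S' \subset y |: V1 ->
    clique e K' -> stable_set e S' -> [disjoint K' & S'] ->
    (forall W, K' \subset W -> [disjoint S' & W] ->
       (K \subset ext1 W) /\ (forall z, z \in S -> z \notin ext1 W)) ->
    exists2 W, W \in ext1 @: F1 :|: ext2 @: F2 & (K \subset W) && [disjoint S & W].
  move=> K'V S'V clK' stS' d' H; have [W WF /andP[KW SW]] := sep1 _ _ K'V S'V clK' stS' d'.
  have [KE SE] := H _ KW SW.
  exists (ext1 W); first by apply/setUP; left; apply: imset_f.
  by rewrite KE disjoint_subset; apply/subsetP => z zS; exact: (SE z zS).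
have use2 K S K' S' : K' \subset x |: V2 -> S' \subset x |: V2 ->
    clique e K' -> stable_set e S' -> [disjoint K' & S'] ->
    (forall W, K' \subset W -> [disjoint S' & W] ->
       (K \subset ext2 W) /\ (forall z, z \in S -> z \notin ext2 W)) ->
    exists2 W, W \in ext1 @: F1 :|: ext2 @: F2 & (K \subset W) && [disjoint S & W].
  move=> K'V S'V clK' stS' d' H; have [W WF /andP[KW SW]] := sep2 _ _ K'V S'V clK' stS' d'.
  have [KE SE] := H _ KW SW.
  exists (ext2 W); first by apply/setUP; right; apply: imset_f.
  by rewrite KE disjoint_subset; apply/subsetP => z zS; exact: (SE z zS).
move=> K S KV SV clK stS dKS.
have dK z : z \in K -> z \in S -> False by move=> zK; rewrite (disjointFr dKS zK).
have covE z : z \in V -> [|| z \in E, z \in A1, z \in C, z \in B2 | z \in A2].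
  by move/(subsetP covV); rewrite !inE -!orbA.
have adjK z t : z \in K -> t \in K -> z != t -> e z t by move=> zK tK; apply: clK.
have yE : y \notin E by apply/negP => yE; move: (cEB _ _ yE yB2); rewrite eirr.
have yC : y \notin C by apply/negP => /cCy; rewrite eirr.
have yA : y \notin A1 by rewrite (disjointFl dAB yB2).
have xC : x \notin C by apply/negP => xC; move: (cEC _ _ xE xC); rewrite eirr.
have xB : x \notin B2 by apply/negP => xB; move: (cEB _ _ xE xB); rewrite eirr.
have xA : x \notin A2 by rewrite (disjointFr dEA2 xE).
have stE z t : z \in S -> t \in S -> e z t -> False.
  by move=> zS tS; apply/negP/stS.
have inK K0 S0 : [disjoint K0 & S0] -> forall z, z \in S0 -> z \in K0 -> False.
  by move=> d z zS zK; rewrite (disjointFr d zK) in zS.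
have mkd (K0 S0 : {set T}) : (forall z, z \in K0 -> z \in S0 -> False) -> [disjoint K0 & S0].
  by move=> H; rewrite disjoint_subset; apply/subsetP => z zK; rewrite inE; apply/negP => /(H z zK).
have [KA1|[a]] := set_0Vmem (K :&: A1); last first.
  rewrite inE => /andP[aK aA].
  have KV1 : K \subset V1.
    apply/subsetP => z zK; rewrite !inE; have [->|zna] := eqVneq z a.
      by rewrite aA orbT.
    have eaz := adjK _ _ zK aK zna; rewrite esym in eaz.
    case/or4P: (covE _ (subsetP KV _ zK)) => [->|->|->|/orP[zB|zA]]; rewrite ?orbT //.
      by move: (aAB _ _ aA zB); rewrite eaz.
    by move: (aAA _ _ aA zA); rewrite eaz.
  (* The marker [y] joins the stable set only when the rest of it lies in [A1], which misses [y].
     When [S] meets both [C] and [B2], its vertex in [C] keeps [C] from lying in [W], and [ext1]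
     omits [B2]. *)
  pose addy := (S :&: B2 != set0) && (S :&: (E :|: C) == set0).
  have SEC z : addy -> z \in S -> z \in V1 -> z \in A1.
    move=> /andP[_ /eqP/setP/(_ z)]; rewrite !inE => SEC zS.
    by move: SEC; rewrite zS /=; case: (z \in E) => //=; case: (z \in C) => //; rewrite orbF.
  pose S' := [set z | (z \in S) && (z \in V1) || addy && (z == y)].
  apply: (use1 _ _ K S') => //.
  - by apply: subset_trans KV1 (subsetUr _ _).
  - apply/subsetP => z; rewrite !inE => /orP[/andP[_ ->]|/andP[_ ->]] //.
    by rewrite orbT.
  - move=> z t; rewrite !inE => /orP[/andP[zS zV]|/andP[ay /eqP->]].
      move=> /orP[/andP[tS tV]|/andP[ay' /eqP->]]; first exact: stS.
      by apply: aAB => //; apply: SEC => //; rewrite !inE.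
    move=> /orP[/andP[tS tV]|/andP[_ /eqP->]]; last by rewrite eirr.
    by rewrite esym; apply: aAB => //; apply: SEC => //; rewrite !inE.
  - apply: mkd => z zK; rewrite inE => /orP[/andP[zS _]|/andP[_ /eqP zy]].
      exact: (dK z).
    by move: (subsetP KV1 _ zK); rewrite zy !inE (negPf yE) (negPf yA) (negPf yC).
  - move=> W KW SW; split.
      by apply/subsetP => z zK; rewrite in_ext1 (subsetP KW _ zK) (subsetP KV1 _ zK).
    move=> z zS; rewrite in_ext1 negb_or; apply/andP; split.
      apply/negP => /andP[zW zV]; apply: (inK _ _ _ z (_ : z \in S') zW).
        by rewrite disjoint_sym.
      by rewrite inE zS zV.
    apply/and3P => -[zB yW CW].
    have SB : S :&: B2 != set0 by apply/set0Pn; exists z; rewrite inE zS.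
    have [SECn|[c]] := set_0Vmem (S :&: (E :|: C)).
      apply: (inK W S' _ y) yW; first by rewrite disjoint_sym.
      by rewrite inE eqxx /addy SB SECn eqxx orbT.
    rewrite !inE => /andP[cS /orP[cE|cC]]; first exact: (stE _ _ cS zS (cEB _ _ cE zB)).
    apply: (inK W S' _ c) (subsetP CW _ cC); first by rewrite disjoint_sym.
    by rewrite !inE cS cC !orbT.
have KnA z : z \in K -> z \in A1 -> False.
  by move=> zK zA; move/setP/(_ z): KA1; rewrite !inE zK zA.
have inV2 z : z \in V -> z \notin E -> z \notin A1 -> z \in V2.
  by move=> /covE; rewrite !inE => /or4P[->|->|->|/orP[]->]; rewrite ?orbT.
have [SE|[s0]] := set_0Vmem (S :&: E).
  have SnE z : z \in S -> z \in E -> False.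
    by move=> zS zE; move/setP/(_ z): SE; rewrite !inE zS zE.
  (* The marker [x] stands for [K :&: E]. A clique meeting [E] misses [A2], so [x] is adjacent to
     the rest of [K']. *)
  pose K' := [set z | (z \in K) && (z \in V2) || (K :&: E != set0) && (z == x)].
  have xK z : z \in K -> z \in V2 -> K :&: E != set0 -> z != x -> e z x.
    move=> zK zV /set0Pn[k0]; rewrite inE => /andP[k0K k0E] zx; rewrite esym.
    move: zV; rewrite !inE => /orP[/orP[zB|zA]|zC].
    - exact: cEB.
    - have zk0 : k0 != z by apply: contraTneq k0E => ->; rewrite (disjointFl dEA2 zA).
      by move: (aEA _ _ k0E zA); rewrite adjK.
    - exact: cEC.
  apply: (use2 _ _ K' (S :&: V2)).
  - apply/subsetP => z; rewrite !inE => /orP[/andP[_ ->]|/andP[_ ->]] //.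
    by rewrite orbT.
  - by apply: subset_trans (subsetIr _ _) (subsetUr _ _).
  - move=> z t; rewrite !inE => /orP[/andP[zK zV]|/andP[KE /eqP->]].
      move=> /orP[/andP[tK tV]|/andP[KE /eqP->]]; first exact: clK.
      by apply: xK => //; rewrite !inE.
    move=> /orP[/andP[tK tV]|/andP[_ /eqP->]]; last by rewrite eqxx.
    by rewrite eq_sym => tx; rewrite esym; apply: xK => //; rewrite !inE.
  - by move=> z t; rewrite !inE => /andP[zS _] /andP[tS _]; apply: stS.
  - apply: mkd => z; rewrite inE => /orP[/andP[zK _]|/andP[_ /eqP->]].
      by rewrite inE => /andP[zS _]; apply: (dK z).
    by rewrite inE => /andP[xS _]; apply: (SnE x).
  - move=> W KW SW; split.
      apply/subsetP => z zK; rewrite in_ext2.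
      have [zE|znE] := boolP (z \in E).
        have -> : x \in W.
          apply: (subsetP KW); rewrite inE eqxx andbT; apply/orP; right.
          by apply/set0Pn; exists z; rewrite inE zK.
        by rewrite orbT.
      have zV2 : z \in V2 by apply: inV2 => //; [apply: (subsetP KV)|apply/negP => /(KnA z zK)].
      by rewrite zV2 (subsetP KW) // inE zK zV2.
    move=> z zS; rewrite in_ext2 negb_or; apply/andP; split.
      apply/negP => /andP[zW zV]; apply: (inK _ _ _ z (_ : z \in S :&: V2) zW).
        by rewrite disjoint_sym.
      by rewrite inE zS zV.
    by apply/andP => -[zE _]; apply: (SnE z).
rewrite inE => /andP[s0S s0E].
have SnB z : z \in S -> z \in B2 -> False.
  by move=> zS zB; apply: (stE _ _ s0S zS); apply: cEB.
have SnC z : z \in S -> z \in C -> False.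
  by move=> zS zC; apply: (stE _ _ s0S zS); apply: cEC.
have [KE|[k0]] := set_0Vmem (K :&: E).
  have KnE z : z \in K -> z \in E -> False.
    by move=> zK zE; move/setP/(_ z): KE; rewrite !inE zK zE.
  have KV2 : K \subset V2.
    apply/subsetP => z zK; apply: inV2; first exact: (subsetP KV).
      by apply/negP/(KnE z).
    by apply/negP/(KnA z).
  (* As [S] meets [E], it misses [B2] and [C]; what it has in [V2] lies in [A2], which misses
     [x]. *)
  pose S' := x |: (S :&: V2).
  have SA z : z \in S -> z \in V2 -> z \in A2.
    by rewrite !inE => zS /orP[/orP[/(SnB z zS)|]|/(SnC z zS)].
  apply: (use2 _ _ K S') => //.
  - by apply: subset_trans KV2 (subsetUr _ _).
  - by apply: setUS; apply: subsetIr.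
  - move=> z t; rewrite /S' [in z \in _]inE [in t \in _]inE !in_set1 !in_setI.
    move=> /orP[/eqP->|/andP[zS zV]] /orP[/eqP->|/andP[tS tV]].
    + by rewrite eirr.
    + by apply: aEA => //; apply: SA.
    + by rewrite esym; apply: aEA => //; apply: SA.
    + exact: stS.
  - apply: mkd => z zK; rewrite /S' in_setU1 in_setI => /orP[/eqP zx|/andP[zS _]].
      by apply: (KnE z); rewrite // zx.
    exact: (dK z).
  - move=> W KW SW; split.
      by apply/subsetP => z zK; rewrite in_ext2 (subsetP KW) // (subsetP KV2).
    move=> z zS; rewrite in_ext2 negb_or; apply/andP; split.
      apply/negP => /andP[zW zV]; apply: (inK _ _ _ z (_ : z \in S') zW).
        by rewrite disjoint_sym.
      by rewrite /S' in_setU1 in_setI zS zV orbT.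
    apply/andP => -[_ xW]; apply: (inK _ _ _ x (_ : x \in S') xW).
      by rewrite disjoint_sym.
    by rewrite /S' setU11.
rewrite inE => /andP[k0K k0E].
(* Adding [C] and [y] to the clique forces [B2] into [ext1 W]. This is harmless, since [S] meets [E]
   and so avoids [B2] and [C]. *)
pose K' := [set z | [|| (z \in K) && (z \in E), z \in C | z == y]].
apply: (use1 _ _ K' (S :&: V1)).
- apply/subsetP => z; rewrite !inE => /or3P[/andP[_ ->]|->|->] //; by rewrite !orbT.
- by apply: subset_trans (subsetIr _ _) (subsetUr _ _).
- move=> z t; rewrite !inE => /or3P[/andP[zK zE]|zC|/eqP->] /or3P[/andP[tK tE]|tC|/eqP->] zt.
  + exact: clK.
  + exact: cEC.
  + exact: cEB.
  + by rewrite esym; apply: cEC.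
  + exact: clC.
  + exact: cCy.
  + by rewrite esym; apply: cEB.
  + by rewrite esym; apply: cCy.
  + by rewrite eqxx in zt.
- by move=> z t; rewrite !inE => /andP[zS _] /andP[tS _]; apply: stS.
- apply: mkd => z; rewrite [in z \in K']inE in_setI => /or3P[/andP[zK _]|zC|/eqP->] /andP[zS _].
  + exact: (dK z).
  + exact: (SnC z).
  + exact: (SnB y).
- move=> W KW SW.
  have CW : C \subset W by apply: subset_trans KW; apply/subsetP => z zC; rewrite inE zC orbT.
  have yW : y \in W by apply: (subsetP KW); rewrite inE eqxx !orbT.
  split.
    apply/subsetP => z zK; rewrite in_ext1 yW CW andbT.
    case/or4P: (covE _ (subsetP KV _ zK)) => [zE|/(KnA z zK)//|zC|/orP[->|zA]]; rewrite ?orbT //.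
    + by rewrite (subsetP KW) ?inE ?zE ?zK ?orbT.
    + by rewrite (subsetP CW) ?inE ?zC ?orbT.
    + have zk0 : k0 != z by apply: contraTneq k0E => ->; rewrite (disjointFl dEA2 zA).
      by move: (aEA _ _ k0E zA); rewrite adjK.
  move=> z zS; rewrite in_ext1 negb_or; apply/andP; split.
    apply/negP => /andP[zW zV]; apply: (inK _ _ _ z (_ : z \in S :&: V1) zW).
      by rewrite disjoint_sym.
    by rewrite inE zS zV.
  by apply/and3P => -[zB _ _]; apply: (SnB z).
Qed.

End Separable.

(** * Components of the non-neighbours of a vertex *)

(** The subgraph induced by [Z] is kept as a relation on [T], so that [connect] needs no subtype; a
    vertex outside [Z] is connected only to itself. *)
Definition restr (T : finType) (e : rel T) (Z : {set T}) : rel T :=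
  [rel x y | [&& x \in Z, y \in Z & e x y]].

Section CapFree.

Variables (T : finType) (e : rel T).
Hypotheses (esym : symmetric e) (eirr : irreflexive e) (capF : cap_free e).
Implicit Types (x y z : T) (V K S W Z L B Q : {set T}).

Lemma connect_inv (r : rel T) (P : pred T) x y :
  connect r x y -> (forall a b, r a b -> P a -> P b) -> P x -> P y.
Proof.
move=> /connectP[p pth ->] rP; elim: p x pth => //= z p IHp x /andP[rxz pth] Px.
by apply: IHp pth _; apply: rP rxz Px.
Qed.

Lemma restr_sym Z : symmetric (restr e Z).
Proof. by move=> x y; rewrite /restr /= esym andbCA. Qed.

Lemma connect_restr_sym Z : connect_sym (restr e Z).
Proof. exact/sym_connect_sym/restr_sym. Qed.

Lemma restr_path Z x p :
  path (restr e Z) x p -> path e x p /\ {subset p <= Z}.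
Proof.
elim: p x => //= y p IHp x /andP[/and3P[_ yZ exy] /IHp[pth sub]].
split; first by rewrite exy.
by move=> z; rewrite inE => /orP[/eqP->|/sub].
Qed.

Lemma connect_restr_mem Z x y : connect (restr e Z) x y -> x \in Z -> y \in Z.
Proof. by move=> xy; apply: (connect_inv (P := mem Z) xy) => a b /= /and3P[]. Qed.

(* For two vertices of K, a path of Q between neighbours of them contains a
   common neighbour, so a vertex of Q with as many neighbours in K as possible
   sees all of K. *)
Lemma clique_common_neighbour v q0 K Q :
    q0 \in Q -> {in Q &, forall x y, connect (restr e Q) x y} ->
    clique e K -> {in K, forall k, e v k} -> {in Q, forall q, ~~ e v q} ->
    {in K, forall k, exists2 q, q \in Q & e k q} ->
  exists2 q, q \in Q & {in K, forall k, e q k}.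
Proof.
move=> q0Q connQ clK vK vQ KQ; pose N q := [set k in K | e q k].
case: (arg_maxnP (fun q => #|N q|) q0Q) => q qQ qmax; exists q => // k0 k0K.
apply/negPn/negP => nqk0; have [r rQ ek0r] := KQ _ k0K.
have /connectP[p pth rE] := connQ _ _ qQ rQ.
have [pthp subp] := restr_path pth.
have hasp : has (e k0) p.
  apply/hasP; exists r => //; move: (mem_last q p); rewrite -rE inE.
  by case/orP=> // /eqP rq; rewrite -rq esym ek0r in nqk0.
case: (split_find hasp) pthp subp => x s1 s2 ek0x nos1; rewrite cat_path.
move=> /andP[pth1 _] sub1; have subQ z : z \in q :: rcons s1 x -> z \in Q.
  rewrite inE => /orP[/eqP->//|zs]; apply: sub1.
  by rewrite mem_cat zs.
(* [x] is the first neighbour of [k0] after [q], so on the path from [k1] through [q] and [x] to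
   [k0] only [x] can be adjacent to both ends. *)
have xN k1 : k1 \in K -> e q k1 -> e x k1.
  move=> k1K eqk1; have k10 : k1 != k0 by apply: contraNneq nqk0 => <-.
  have [|z] := @common_neighbour _ e esym eirr capF k1 k0 v (q :: rcons s1 x)
    (clK _ _ k1K k0K k10) (vK _ k1K) (vK _ k0K) _ isT (fun z zq => vQ z (subQ z zq)).
    by rewrite /= esym eqk1 rcons_path pth1 last_rcons esym ek0x.
  rewrite inE mem_rcons inE => /or3P[/eqP->|/eqP->|zs1] /andP[ek1z ezk0].
  - by rewrite ezk0 in nqk0.
  - by rewrite esym.
  - by move/hasPn: nos1 => /(_ _ zs1); rewrite esym ezk0.
suff : #|N q| < #|N x|.
  by rewrite ltnNge => /negP[]; apply/qmax/subQ; rewrite inE mem_rcons mem_head orbT.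
apply: proper_card; apply/properP; split.
  by apply/subsetP => k; rewrite !inE => /andP[kK qk]; rewrite kK xN.
by exists k0; rewrite !inE k0K // esym.
Qed.

(** If [K] misses [L], the separator of [B :|: Q] suffices. Otherwise [K] lies in [L :|: B]. If [S]
    meets [L], it misses [B], and [B] can join the clique side. If [S] misses [L], a cut of [F3]
    works: [L :|: B] if [S] misses [B], [g] if some vertex of [S] misses at most one vertex of
    [K :&: B], and otherwise [f] at a vertex of [Q] complete to [K :&: B]. *)
Lemma separable_components V L B Q n1 n2 :
    V \subset L :|: (B :|: Q) -> complete e L B -> anticomplete e L Q ->
    {in Q &, forall x y, connect (restr e Q) x y} ->
    {in B, forall b, exists2 q, q \in Q & e b q} ->
    (forall v p k k' s, v \in L -> p \in Q -> k \in B -> k' \in B -> s \in B ->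
       e k k' -> ~~ e s k -> ~~ e s k' -> e p k -> e p k' -> e p s -> False) ->
    separable e L n1 -> separable e (B :|: Q) n2 ->
  separable e V (n1 + n2 + (#|T| + #|T| * #|T|).+1).
Proof.
move=> covV cLB aLQ connQ BQ noconf [F1 sep1 le1] [F2 sep2 le2].
pose f q := L :|: [set b in B | e q b].
pose g (p : T * T) := p.2 |: (L :|: [set b | e p.1 b]).
pose F3 := (L :|: B) |: (f @: [set: T] :|: g @: [set: T * T]).
have le3 : #|F3| <= (#|T| + #|T| * #|T|).+1.
  apply: leq_trans (leq_card_setU _ _) _; rewrite cards1 add1n ltnS.
  apply: leq_trans (leq_card_setU _ _) _; rewrite -card_prod -!cardsT.
  by apply: leq_add; apply: leq_imset_card.
pose e1 W := (W :&: L) :|: B; pose e2 W := W :&: (B :|: Q).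
exists (e1 @: F1 :|: e2 @: F2 :|: F3); last first.
  apply: leq_trans (leq_card_setU _ _) _; apply: leq_add => //.
  apply: leq_trans (leq_card_setU _ _) _.
  by apply: leq_add; [apply: leq_trans le1|apply: leq_trans le2]; apply: leq_imset_card.
move=> K S KV SV clK stS dKS.
have dK z : z \in K -> z \in S -> False by move=> zK; rewrite (disjointFr dKS zK).
have stE z t : z \in S -> t \in S -> e z t -> False.
  by move=> zS tS; apply/negP/stS.
have mkd (K0 S0 : {set T}) : (forall z, z \in S0 -> z \in K0 -> False) -> [disjoint S0 & K0].
  by move=> H; rewrite disjoint_subset; apply/subsetP => z zK; rewrite inE; apply/negP => /(H z zK).
have use3 W : W \in F3 -> {subset K <= W} -> (forall z, z \in S -> z \in W -> False) ->
    exists2 W, W \in e1 @: F1 :|: e2 @: F2 :|: F3 & (K \subset W) && [disjoint S & W].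
  move=> WF KW SW; exists W; first by apply/setUP; right.
  by apply/andP; split; [apply/subsetP|apply: mkd].
have [KL|[l]] := set_0Vmem (K :&: L).
  have KBQ : K \subset B :|: Q.
    apply/subsetP => z zK; move: (subsetP covV _ (subsetP KV _ zK)).
    by rewrite inE => /orP[zL|//]; move/setP/(_ z): KL; rewrite !inE zK zL.
  have [||W WF /andP[KW SW]] := sep2 K (S :&: (B :|: Q)) KBQ (subsetIr _ _) clK.
  - by move=> z t /setIP[zS _] /setIP[tS _]; apply: stS.
  - by rewrite disjoint_sym; apply: mkd => z /setIP[zS _] zK; apply: (dK z).
  exists (e2 W); first by apply/setUP; left; apply/setUP; right; apply: imset_f.
  apply/andP; split; first by rewrite subsetI KW.
  apply: mkd => z zS /setIP[zW zBQ].
  by move: (disjointFl SW zW); rewrite inE zS zBQ.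
rewrite inE => /andP[lK lL].
have KLB z : z \in K -> z \in L \/ z \in B.
  move=> zK; have [zL|znL] := boolP (z \in L); first by left.
  move: (subsetP covV _ (subsetP KV _ zK)); rewrite !inE (negPf znL) /=.
  case/orP=> [|zQ]; first by right.
  have lz : l != z by apply: contraNneq znL => <-.
  by move: (aLQ _ _ lL zQ); rewrite clK.
have [SL|[s]] := set_0Vmem (S :&: L); last first.
  rewrite inE => /andP[sS sL].
  have [|||W WF /andP[KW SW]] := sep1 (K :&: L) (S :&: L) (subsetIr _ _) (subsetIr _ _).
  - by move=> z t /setIP[zS _] /setIP[tS _]; apply: clK.
  - by move=> z t /setIP[zS _] /setIP[tS _]; apply: stS.
  - by rewrite disjoint_sym; apply: mkd => z /setIP[zS _] /setIP[zK _]; apply: (dK z).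
  exists (e1 W); first by apply/setUP; left; apply/setUP; left; apply: imset_f.
  apply/andP; split.
    apply/subsetP => z zK; case: (KLB z zK) => [zL|zB]; last by rewrite inE zB orbT.
    by apply/setUP; left; rewrite inE zL andbT (subsetP KW) // inE zK.
  apply: mkd => z zS /setUP[/setIP[zW zL]|zB].
    by move: (disjointFl SW zW); rewrite inE zS zL.
  by apply: (stE s z) => //; apply: cLB.
have SnL z : z \in S -> z \in L -> False.
  by move=> zS zL; move/setP/(_ z): SL; rewrite !inE zS zL.
have [SB|[s0]] := set_0Vmem (S :&: B).
  apply: (use3 (L :|: B)); first by rewrite setU11.
    by move=> z /KLB[]; rewrite inE => ->; rewrite ?orbT.
  move=> z zS /setUP[/(SnL z zS)//|zB].
  by move/setP/(_ z): SB; rewrite !inE zS zB.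
rewrite inE => /andP[s0S s0B].
pose almost p := [forall k in K :&: B, (k == p.2) || e p.1 k].
have [/existsP[[s k] /andP[/andP[/= sS kK] /forall_inP sk]]|none] :=
  boolP [exists p : T * T, [&& p.1 \in S & p.2 \in K] && almost p].
  apply: (use3 (g (s, k))).
  - by apply/setUP; right; apply/setUP; right; apply: imset_f.
  - move=> z zK; rewrite !inE /=; case: (KLB z zK) => [->|zB]; first by rewrite orbT.
    have zKB : z \in K :&: B by rewrite inE zK.
    by case/orP: (sk _ zKB) => ->; rewrite ?orbT.
  - move=> z zS; rewrite !inE /= => /or3P[/eqP zk|/(SnL z zS)//|].
      by apply: (dK z) => //; rewrite zk.
    exact: stE.
have notalmost s k : s \in S -> k \in K ->
    exists2 k', k' \in K :&: B & (k' != k) && ~~ e s k'.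
  move=> sS kK; move/existsPn: none => /(_ (s, k)); rewrite sS kK /= => /forall_inPn[k' k'K].
  by rewrite negb_or => H; exists k'.
have [q1 q1Q _] := BQ _ s0B.
have [|||k|q qQ qK] := @clique_common_neighbour l q1 (K :&: B) Q q1Q connQ.
- by move=> z t /setIP[zS _] /setIP[tS _]; apply: clK.
- by move=> k /setIP[_ kB]; apply: cLB.
- by move=> q qQ; apply: aLQ.
- by move=> /setIP[_ kB]; apply: BQ.
apply: (use3 (f q)).
- by apply/setUP; right; apply/setUP; left; apply: imset_f.
- move=> z zK; rewrite !inE; case: (KLB z zK) => [->//|zB].
  by rewrite zB qK ?orbT // inE zK.
move=> z zS; rewrite !inE => /orP[/(SnL z zS)//|/andP[zB eqz]].
(* The first call only serves to find some non-neighbour [k1] of [z], the second finds another one.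
   As [q] sees [z], the excluded configuration appears. *)
have [k1 k1KB /andP[_ nzk1]] := notalmost z l zS lK.
have /setIP[k1K k1B] := k1KB.
have [k2 k2KB /andP[k21 nzk2]] := notalmost z k1 zS k1K.
have /setIP[k2K k2B] := k2KB.
by apply: (noconf l q k2 k1 z) => //; [apply: clK|apply: qK|apply: qK].
Qed.

(* If l in L missed b in B, then Q and b would lie in one component of the
   non-neighbours of l, against the maximality of Q. *)
Lemma exists_full_component V : ~ clique e V ->
  exists L B Q : {set T},
    [/\ V = L :|: (B :|: Q), [disjoint L & B :|: Q], L != set0 & Q != set0] /\
    [/\ complete e L B, anticomplete e L Q,
      {in Q &, forall x y, connect (restr e Q) x y} &
      {in B, forall b, exists2 q, q \in Q & e b q}].
Proof.
move=> ncl; pose nonN v := [set x in V | (x != v) && ~~ e v x].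
pose comp (p : T * T) := [set x | connect (restr e (nonN p.1)) p.2 x].
pose good (p : T * T) := (p.1 \in V) && (p.2 \in nonN p.1).
have [p0 p0good] : exists p, good p.
  have [/existsP//|/existsPn nogood] := boolP [exists p, good p].
  case: ncl => x y xV yV xy.
  by move: (nogood (x, y)); rewrite /good !inE xV yV /= eq_sym xy /= negbK.
case: (arg_maxnP (fun p => #|comp p|) p0good) => -[v w] /andP[/= vV wn] vmax.
pose Q := comp (v, w).
have wQ : w \in Q by rewrite inE connect0.
have Qn x : x \in Q -> x \in nonN v by rewrite inE => /connect_restr_mem; apply.
have QV x : x \in Q -> x \in V by move/Qn; rewrite inE => /andP[].
pose B := [set b in V :\: Q | [exists q in Q, e b q]].
have inB x : (x \in B) = [&& x \notin Q, x \in V & [exists q in Q, e x q]].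
  by rewrite inE in_setD andbA.
pose L := V :\: (B :|: Q).
have BQV : B :|: Q \subset V.
  by apply/subsetP => x; rewrite inE => /orP[|/QV//]; rewrite inB => /and3P[].
have inL x : x \in L -> [/\ x \in V, x \notin B & x \notin Q].
  by rewrite inE in_setU negb_or => /andP[/andP[-> ->] ->].
have aLQ : anticomplete e L Q.
  move=> x q /inL[xV xB xQ] qQ; apply: contra xB => exq.
  by rewrite inB xV xQ; apply/exists_inP; exists q.
(* Every vertex of [Q] is reached from [w] along edges inside [Q]; this induction carries
   connectivity from the non-neighbours of [v] over to those of [l], and to [Q] itself. *)
have stepQ (P : pred T) : P w -> (forall a b, a \in Q -> b \in Q -> e a b -> P a -> P b) ->
    forall x, x \in Q -> P x.
  move=> Pw Pstep x xQ; pose P' := [pred z | (z \in Q) && P z].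
  suff /andP[] : P' x by [].
  move: (xQ); rewrite inE => wx; apply: (connect_inv wx); last by rewrite /= wQ.
  move=> a b /= /and3P[aN bN eab] /andP[aQ Pa].
  have bQ : b \in Q.
    rewrite inE; move: aQ; rewrite inE => /connect_trans; apply.
    by apply: connect1; apply/and3P; split.
  by rewrite bQ (Pstep a b).
exists L, B, Q; split; split.
- by rewrite setUC -[LHS](setID V (B :|: Q)) (setIidPr BQV).
- rewrite -setI_eq0; apply/eqP/setP => x; rewrite in_setI in_setD in_set0.
  by case: (x \in B :|: Q); rewrite ?andbF.
- apply/set0Pn; exists v; rewrite inE vV andbT inE negb_or; apply/andP; split.
    rewrite inB !negb_and; apply/orP; right; apply/orP; right; apply/exists_inPn => q /Qn.
    by rewrite inE => /andP[_ /andP[_]].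
  by apply/negP => /Qn; rewrite inE eqxx andbF.
- by apply/set0Pn; exists w.
- move=> l b lL bB; apply/negPn/negP => nlb; have [lV lB lQ] := inL _ lL.
  have Ql x : x \in Q -> x \in nonN l.
    move=> xQ; rewrite inE (QV _ xQ) aLQ // andbT /=.
    by apply: contraNneq lQ => <-.
  move: bB; rewrite inB => /and3P[bQ bV /exists_inP[q qQ ebq]].
  have Qsub x : x \in Q -> connect (restr e (nonN l)) w x.
    apply: stepQ; first exact: connect0.
    move=> a c aQ cQ eac /connect_trans; apply.
    by apply: connect1; apply/and3P; split; rewrite //= Ql.
  have bl : b \in nonN l.
    rewrite inE bV nlb andbT /=; apply: contraNneq lB => <-.
    by rewrite inB bQ bV; apply/exists_inP; exists q.
  suff : #|Q| < #|comp (l, w)|.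
    rewrite ltnNge => /negP[]; apply: (vmax (l, w)).
    by rewrite /good /= lV Ql.
  apply: proper_card; apply/properP; split.
    by apply/subsetP => x xQ; rewrite inE Qsub.
  exists b => //; rewrite inE; apply: connect_trans (Qsub _ qQ) _.
  by apply: connect1; apply/and3P; split; [exact: Ql|exact: bl|rewrite esym].
- exact: aLQ.
- move=> x y xQ yQ; have wx z : z \in Q -> connect (restr e Q) w z.
    apply: stepQ; first exact: connect0.
    move=> a c aQ cQ eac /connect_trans; apply.
    by apply: connect1; apply/and3P; split.
  by apply: connect_trans (wx _ yQ); rewrite connect_restr_sym; apply: wx.
- by move=> b; rewrite inB => /and3P[_ _ /exists_inP].
Qed.
End CapFree.

(** * Homogeneity of vertices linked to a join by a path *)

Section CapFree.

Variables (T : finType) (e : rel T).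
Hypotheses (esym : symmetric e) (eirr : irreflexive e) (capF : cap_free e).
Implicit Types (x y z : T) (V X Y E D : {set T}).

(** Serves to shortcut a path leaving [f]: after [q], only the endpoint [y] may still see [f]. *)
Lemma last_neighbour f a p y : path e a (rcons p y) -> has (e f) (a :: p) ->
  exists q r, [/\ path e q (rcons r y), e f q, {subset q :: r <= a :: p},
    size r <= size p & {in r, forall z, ~~ e f z}].
Proof.
elim: p a => [|b p IHp] a pth.
  by rewrite /= orbF => efa; exists a, [::]; split.
have [hasp _|nop] := boolP (has (e f) (b :: p)).
  move: pth => /= /andP[_ pth].
  have [q [r [pthq efq sub sz nor]]] := IHp _ pth hasp.
  exists q, r; split=> //; last exact: leqW.
  by move=> z /sub zbp; rewrite inE zbp orbT.
rewrite [has _ _]/= -/(has _ (b :: p)) (negPf nop) orbF => efa.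
by exists a, (b :: p); split=> // z zp; move/hasPn: nop => /(_ z zp).
Qed.

Section Homogeneous.

Variables E D Y : {set T}.
Hypotheses (cEY : complete e E Y)
  (EDY : forall x d y, x \in E -> d \in D -> y \in Y -> e d x -> ~~ e d y).

(* The neighbours d, f of x are followed on the path by a third one, hence by
   induction by all vertices of the path, but the last but one is in D. *)
Lemma no_fan p x d f y : x \in E -> d \in D -> f \in D -> y \in Y ->
  e d f -> e d x -> e f x -> path e f (rcons p y) -> {subset p <= D} ->
  {in p, forall z, ~~ e d z} -> False.
Proof.
move=> xE + + yY; have [n] := ubnP (size p); elim: n p d f => // n IHn p d f.
rewrite ltnS => szp dD fD edf edx efx pth pD dp.
have nfy := EDY xE fD yY efx; have ndy := EDY xE dD yY edx.
case: p szp pth pD dp => [|a p] szp; first by rewrite /= andbT (negPf nfy).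
rewrite rcons_cons => /andP[efa pth] pD dp.
have [|q [r [pthq efq sub szr fr]]] := @last_neighbour f a p y pth.
  by rewrite /= efa.
have [||z] := @common_neighbour _ e esym eirr capF f x d (q :: rcons r y) efx edf edx _ isT.
- by rewrite /= efq rcons_path pthq last_rcons esym cEY.
- move=> z; rewrite inE mem_rcons inE => /or3P[/eqP->|/eqP->//|zr].
    by apply/dp/sub/mem_head.
  by apply/dp/sub; rewrite inE zr orbT.
rewrite inE mem_rcons inE => /or3P[/eqP->|/eqP->|zr] /andP[efz ezx].
- apply: (IHn r f q) => //.
  + exact: leq_ltn_trans szr _.
  + exact/pD/sub/mem_head.
  + by move=> z1 zr; apply/pD/sub; rewrite inE zr orbT.
- by rewrite efz in nfy.
- by move: (fr _ zr); rewrite efz.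
Qed.

(** The last neighbour [q] of [d] on the path misses [x1] by [no_fan], and by induction no vertex
    from [q] on distinguishes [x1] from [x2]. If [d] did, let [w] be the first neighbour of [x1]
    after [q]: the path from [x1] through [d] and [q] to [w], with [x2] as the vertex seeing only
    its ends, would contradict [common_neighbour]. *)
Lemma homogeneous p d y x1 x2 : d \in D -> y \in Y -> path e d (rcons p y) ->
  {subset p <= D} -> x1 \in E -> x2 \in E -> e x1 x2 -> e d x1 -> e d x2.
Proof.
move=> + yY; have [n] := ubnP (size p); elim: n p d x1 x2 => // n IHn p d x1 x2.
rewrite ltnS => szp dD pth pD x1E x2E e12 ed1; apply/negPn/negP => nd2.
have ndy := EDY x1E dD yY ed1.
case: p szp pth pD => [|a p] szp; first by rewrite /= andbT (negPf ndy).
rewrite rcons_cons => /andP[eda pth] pD.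
have [|q [r [pthq edq sub szr dr]]] := @last_neighbour d a p y pth.
  by rewrite /= eda.
have {}sub z : z \in q :: r -> z \in D by move/sub/pD.
have qD := sub _ (mem_head q r).
have rD : {subset r <= D} by move=> z zr; apply: sub; rewrite inE zr orbT.
have [eq1|nq1] := boolP (e q x1).
  exact: (no_fan x1E dD qD yY edq ed1 eq1 pthq).
have hom z u1 u2 : z \in q :: rcons r y -> u1 \in E -> u2 \in E -> e u1 u2 ->
    e z u1 -> e z u2.
  rewrite inE mem_rcons inE => /or3P[/eqP->|/eqP->|zr] u1E u2E e12'.
  - by apply: (IHn r q) => //; apply: leq_ltn_trans szr _.
  - by move=> _; rewrite esym cEY.
  - case/splitPr: zr pthq rD szr => r1 r2; rewrite rcons_cat cat_path /=.
    move=> /and3P[_ _ pthz] rD szr.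
    apply: (IHn r2 z) => //.
    + apply: leq_trans szp; rewrite /= ltnS; apply: leq_trans szr.
      by rewrite size_cat /= addnS leqW // leq_addl.
    + by apply: rD; rewrite mem_cat mem_head orbT.
    + by move=> z1 z1r; apply: rD; rewrite mem_cat inE z1r !orbT.
have hasr : has (e x1) (rcons r y).
  by apply/hasP; exists y; rewrite ?mem_rcons ?mem_head ?cEY.
have [s1 [w [s2 [rE e1w nos1]]]] : exists s1 w s2,
    [/\ rcons r y = rcons s1 w ++ s2, e x1 w & ~~ has (e x1) s1].
  by case: (split_find hasr) => w s1 s2; exists s1, w, s2.
have wr : w \in rcons r y by rewrite rE mem_cat mem_rcons mem_head.
have s1r z : z \in q :: s1 -> z \in q :: rcons r y.
  by rewrite !inE rE mem_cat mem_rcons inE => /orP[->//|->]; rewrite !orbT.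
have nos z : z \in q :: s1 -> ~~ e x1 z.
  rewrite inE => /orP[/eqP->|zs]; first by rewrite esym.
  by move/hasPn: nos1 => /(_ z zs).
move: pthq; rewrite rE cat_path => /andP[pths _].
have e2w : e x2 w by rewrite esym (hom w x1 x2) // 1?esym // inE wr orbT.
have [|||z] := @common_neighbour _ e esym eirr capF x1 w x2 (d :: q :: s1) e1w _ e2w _ isT.
- by rewrite esym.
- by rewrite /= esym ed1 edq.
- move=> z; rewrite inE => /orP[/eqP->|zs]; first by rewrite esym.
  apply: contra (nos _ zs) => e2z; rewrite esym (hom z x2 x1) ?s1r // esym //.
(* Only [d] could be the common neighbour, but [d] sees nothing after [q], not even [y]. *)
rewrite inE => /orP[/eqP->|zs] /andP[e1z ezw].
  move: wr; rewrite mem_rcons inE => /orP[/eqP wy|/dr]; last by rewrite ezw.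
  by rewrite -wy ezw in ndy.
by move: (nos _ zs); rewrite e1z.
Qed.

End Homogeneous.

(** * Maximal joins with an anticonnected side *)

Definition completeb X Y := [forall x in X, forall y in Y, e x y].

Lemma completeP X Y : reflect (complete e X Y) (completeb X Y).
Proof.
apply: (iffP forall_inP) => [H x y xX yY|H x xX].
  by move/forall_inP: (H x xX); apply.
by apply/forall_inP => y yY; apply: H.
Qed.

(* X is connected in the complement graph. *)
Definition anticonnected X := forall A : {set T},
  {in X &, forall a b, ~~ e a b -> a \in A -> b \in A} ->
  {in X &, forall a b, a \in A -> b \in A}.

(** The last clause bars from [Y] the vertices complete to the rest of the join; such vertices are
    meant for the clique of the amalgam. *)
Definition join_pair V X Y := [/\ X \subset V, Y \subset V, complete e X Y,
  anticonnected X & {in Y, forall y, exists2 y', y' \in Y & (y != y') && ~~ e y y'}].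

(** The boolean form allows a maximal join to be chosen with [arg_maxnP]. *)
Definition join_pairb V X Y := [&& X \subset V, Y \subset V, completeb X Y,
  [forall A : {set T},
     [forall a in X, forall b in X, ~~ e a b ==> (a \in A) ==> (b \in A)] ==>
     [forall a in X, forall b in X, (a \in A) ==> (b \in A)]] &
  [forall y in Y, exists y' in Y, (y != y') && ~~ e y y']].

Lemma join_pairP V X Y : reflect (join_pair V X Y) (join_pairb V X Y).
Proof.
apply: (iffP and5P) => [] [XV YV cXY aX nY]; split=> //.
- exact/completeP.
- move=> A H a b aX' bX' aA.
  have /implyP/(_ _)/forall_inP/(_ a aX')/forall_inP/(_ b bX')/implyP := forallP aX A.
  apply=> //; apply/forall_inP => c cX; apply/forall_inP => d dX.
  by apply/implyP => ncd; apply/implyP; apply: H.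
- by move=> y yY; apply/exists_inP; apply: (forall_inP nY).
- exact/completeP.
- apply/forallP => A; apply/implyP => H.
  apply/forall_inP => a aX'; apply/forall_inP => b bX'; apply/implyP; apply: aX => //.
  move=> c d cX dX ncd.
  by move/forall_inP/(_ c cX)/forall_inP/(_ d dX)/implyP/(_ ncd)/implyP: H.
- by apply/forall_inP => y /nY /exists_inP.
Qed.

End CapFree.

Section CapFree.

Variables (T : finType) (e : rel T).
Hypotheses (esym : symmetric e) (eirr : irreflexive e) (capF : cap_free e).
Implicit Types (x y z : T) (V X Y E D : {set T}).

(** In the complement, every added vertex is linked to [x'] through [t]. *)
Lemma anticonnectedU X Y t x' : anticonnected e X -> x' \in X -> ~~ e t x' ->
  {in Y, forall y, ~~ e t y} -> anticonnected e (X :|: (t |: Y)).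
Proof.
move=> aX xX ntx tY A H.
have tin : t \in X :|: (t |: Y) by rewrite !inE eqxx orbT.
have tA z : z \in X :|: (t |: Y) -> (z \in A) = (t \in A).
  have sA a b : a \in X :|: (t |: Y) -> b \in X :|: (t |: Y) -> ~~ e a b ->
      (a \in A) = (b \in A).
    by move=> aI bI nab; apply/idP/idP; apply: H; rewrite // esym.
  have xA : (x' \in A) = (t \in A).
    by apply: sA; rewrite // 1?esym // inE xX.
  move=> zI; move: (zI); rewrite !inE => /or3P[zX|/eqP->//|zY].
    rewrite -xA.
    have HX : {in X &, forall a b, ~~ e a b -> a \in A -> b \in A}.
      by move=> a b aX' bX'; apply: H; rewrite inE ?aX' ?bX'.
    by apply/idP/idP; apply: (aX A HX).
  by apply: sA => //; rewrite esym tY.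
by move=> a b aI bI; rewrite !tA.
Qed.

Section MaximalJoin.

Variables V X Y : {set T}.
Hypotheses (join : join_pair e V X Y)
  (maxXY : forall X' Y' t, join_pair e V X' Y' -> Y' != set0 -> X \subset X' ->
     X :|: Y \subset X' :|: Y' -> t \in X' :|: Y' -> t \in X :|: Y).

(** If [t] misses vertices of one side only, that side can absorb it, against maximality. If it
    misses vertices of both, anticonnectedness gives nonadjacent [x], [x'] in [X] of which [t] sees
    only [x]. A similar pair in [Y] yields a hole of length 4 that [t] completes to a cap. Without
    one, the neighbours of [t] in [Y] are complete to the rest of [Y], which can move to [X]
    together with [t]. *)
Lemma join_attachment t x0 y0 : t \in V -> t \notin X :|: Y ->
  x0 \in X -> y0 \in Y -> e t x0 -> e t y0 -> {in X :|: Y, forall z, e t z}.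
Proof.
case: join => XV YV cXY aX nY tV tXY x0X y0Y etx0 ety0.
have extV (A B : {set T}) : A \subset V -> B \subset V -> A :|: B \subset V.
  by move=> AV BV; rewrite subUset AV.
have tV1 : [set t] \subset V by rewrite sub1set.
have [cX|/forall_inPn[x1 x1X ntx1]] := boolP [forall x in X, e t x].
  have [cY z|/forall_inPn[y1 y1Y nty1]] := boolP [forall y in Y, e t y].
    by rewrite inE => /orP[]; [apply: (forall_inP cX)|apply: (forall_inP cY)].
  case/negP: (tXY); apply: (@maxXY X (t |: Y)); rewrite ?setUS ?subsetUr //; last first.
  - by rewrite !inE eqxx orbT.
  - by apply/set0Pn; exists t; rewrite setU11.
  split=> //; first exact: extV.
    move=> x y xX; rewrite !inE => /orP[/eqP->|]; last exact: cXY.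
    by rewrite esym (forall_inP cX).
  have ty1 : t != y1 by apply: contraNneq tXY => ->; rewrite inE y1Y orbT.
  move=> y; rewrite !inE => /orP[/eqP->|yY].
    by exists y1; rewrite ?inE ?y1Y ?orbT // ty1.
  by have [y' y'Y yy'] := nY _ yY; exists y' => //; rewrite inE y'Y orbT.
have [cY|/forall_inPn[y1 y1Y nty1]] := boolP [forall y in Y, e t y].
  case/negP: (tXY); apply: (@maxXY (X :|: (t |: set0)) Y).
  - split=> //.
    + by rewrite setU0 extV.
    + move=> x y; rewrite !inE => /or3P[xX|/eqP->|]; rewrite ?orbF //; first exact: cXY.
      by move=> yY; apply: (forall_inP cY).
    + by apply: anticonnectedU aX x1X ntx1 _ => z; rewrite inE.
  - by apply/set0Pn; exists y0.
  - exact: subsetUl.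
  - by rewrite setUAC subsetUl.
  - by rewrite !inE eqxx !orbT.
exfalso.
have [/exists_inP[x /andP[xX etx] /exists_inP[x' /andP[x'X ntx'] nxx']]|none] :=
  boolP [exists (x | (x \in X) && e t x), exists (x' | (x' \in X) && ~~ e t x'), ~~ e x x'];
  last first.
  case/negP: ntx1.
  suff : x1 \in [set z | e t z] by rewrite inE.
  apply: (aX [set z | e t z] _ x0 x1) => //; last by rewrite inE.
  move=> a b aX' bX' nab; rewrite !inE => eta; apply/negPn/negP => ntb.
  case/negP: none; apply/exists_inP; exists a; first by rewrite aX'.
  by apply/exists_inP; exists b; rewrite ?bX'.
have [/exists_inP[y /andP[yY ety] /exists_inP[y' /andP[y'Y nty'] nyy']]|none] :=
  boolP [exists (y | (y \in Y) && e t y), exists (y' | (y' \in Y) && ~~ e t y'), ~~ e y y'].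
  have [||z] := @common_neighbour _ e esym eirr capF x y t [:: y'; x'] (cXY _ _ xX yY) etx ety _ isT.
  - by rewrite /= cXY // esym cXY //= cXY.
  - by move=> z; rewrite !inE => /orP[]/eqP->.
  rewrite !inE => /orP[]/eqP-> /andP[].
    by rewrite [e y' y]esym (negPf nyy').
  by rewrite (negPf nxx').
case/negP: (tXY).
pose Y1 := [set y in Y | e t y]; pose Y2 := [set y in Y | ~~ e t y].
have sep y y' : y \in Y1 -> y' \in Y2 -> e y y'.
  rewrite !inE => yY1 y'Y2; apply/negPn/negP => nyy'; case/negP: none.
  by apply/exists_inP; exists y => //; apply/exists_inP; exists y'.
have Y12 z : z \in Y -> (z \in Y1) || (z \in Y2).
  by rewrite !inE => ->; case: (e t z).
apply: (@maxXY (X :|: (t |: Y2)) Y1).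
- split.
  + apply: (extV) => //; apply: (extV) => //; apply: subset_trans YV.
    by apply/subsetP => z; rewrite inE => /andP[].
  + by apply: subset_trans YV; apply/subsetP => z; rewrite inE => /andP[].
  + move=> z y zI yY1; have yY : y \in Y by move: yY1; rewrite inE => /andP[].
    move: zI; rewrite !inE => /or3P[zX|/eqP->|zY2].
    * exact: cXY.
    * by move: yY1; rewrite inE => /andP[].
    * by rewrite esym; apply: sep => //; rewrite inE.
  + by apply: anticonnectedU aX x1X ntx1 _ => z; rewrite inE => /andP[].
  + move=> y yY1; have yY : y \in Y by move: yY1; rewrite inE => /andP[].
    have [y' y'Y /andP[yy' nyy']] := nY _ yY; exists y'; rewrite ?yy' //.
    case/orP: (Y12 _ y'Y) => // y'Y2.
    by move: (sep _ _ yY1 y'Y2); rewrite (negPf nyy').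
- by apply/set0Pn; exists y0; rewrite inE y0Y.
- exact: subsetUl.
- apply/subsetP => z; rewrite inE => /orP[zX|/Y12/orP[]zY].
  + by rewrite !inE zX.
  + by rewrite inE zY orbT.
  + by rewrite 2!in_setU in_setU1 zY !orbT.
- by rewrite !inE eqxx !orbT.
Qed.

(** Two nonadjacent vertices of this kind could both enter [Y], each being the non-neighbour that
    the other needs there. *)
Lemma join_universal_clique c c' : c \in V -> c' \in V ->
    {in X :|: Y, forall z, e c z} -> {in X :|: Y, forall z, e c' z} ->
  c != c' -> e c c'.
Proof.
case: join => XV YV cXY aX nY cV c'V cU c'U cc'; apply/negPn/negP => ncc'.
have : c \in X :|: Y.
  apply: (@maxXY X (c |: (c' |: Y))).
  - split=> //.
    + by rewrite !subUset !sub1set cV c'V.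
    + move=> x y xX; rewrite !inE => /or3P[/eqP->|/eqP->|yY]; last exact: cXY.
        by rewrite esym cU // inE xX.
      by rewrite esym c'U // inE xX.
    + move=> y; rewrite !inE => /or3P[/eqP->|/eqP->|yY].
      * by exists c'; rewrite ?inE ?eqxx ?orbT ?cc'.
      * by exists c; rewrite ?inE ?eqxx ?orbT // eq_sym cc' esym.
      * by have [y' y'Y yy'] := nY _ yY; exists y' => //; rewrite !inE y'Y !orbT.
  - by apply/set0Pn; exists c; rewrite setU11.
  - by [].
  - by apply: setUS; rewrite setUA subsetUr.
  - by rewrite !inE eqxx orbT.
by move/cU; rewrite eirr.
Qed.

End MaximalJoin.
End CapFree.

(** * The amalgam around a component of the join *)

Section CapFree.

Variables (T : finType) (e : rel T).
Hypotheses (esym : symmetric e) (eirr : irreflexive e) (capF : cap_free e).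
Implicit Types (x y z : T) (V X Y E D : {set T}).

(* Here C is the set of vertices complete to the maximal join (X, Y), E the
   component of k in X, O the vertices reachable from Y outside E and C, and B2
   those of O that are complete to E; the other vertices of O miss E. *)
Lemma exists_amalgam V v p k k' s :
    v \in V -> p \in V -> k \in V -> k' \in V -> s \in V ->
    v != p -> ~~ e v p -> e k k' -> ~~ e s k -> ~~ e s k' ->
    {in [:: v; p], forall z, [/\ e z k, e z k' & e z s]} ->
  exists V1 V2 : {set T}, [/\ V1 \proper V, V2 \proper V, clique e (V1 :&: V2),
    forall n1 n2, separable e V1 n1 -> separable e V2 n2 -> separable e V (n1 + n2) &
    (exists u w, [/\ u \in V :\: V2, w \in V :\: V1, u != w & ~~ e u w]) \/
    ~ clique e V1 /\ ~ clique e V2].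
Proof.
move=> vV pV kV k'V sV vp nvp ekk' nsk nsk' vpE.
have sk : s != k by apply: contraTneq ekk' => <-.
have sk' : s != k' by apply: contraTneq ekk' => <-; rewrite esym.
have kk' : k != k' by apply: contraTneq ekk' => <-; rewrite eirr.
pose X0 := [set k; k'; s]; pose Y0 := [set v; p].
have inY0 y : y \in Y0 -> [/\ e y k, e y k' & e y s].
  by rewrite !inE => yE; apply: vpE; rewrite !inE.
have join0 : join_pair e V X0 Y0.
  split.
  - by rewrite !subUset !sub1set kV k'V.
  - by rewrite subUset !sub1set vV.
  - move=> x y xX /inY0[yk yk' ys]; move: xX; rewrite !inE esym -orbA.
    by case/or3P=> /eqP->.
  - move=> A H.
    have kX : k \in X0 by rewrite !inE eqxx.
    have k'X : k' \in X0 by rewrite !inE eqxx orbT.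
    have sX : s \in X0 by rewrite !inE eqxx orbT.
    have sA x : x \in X0 -> (x \in A) = (s \in A).
      rewrite !inE -orbA => /or3P[]/eqP-> //; apply/idP/idP; apply: H => //; by rewrite esym.
    by move=> a b aX bX; rewrite !sA.
  - move=> y; rewrite !inE => /orP[]/eqP->.
      by exists p; rewrite ?inE ?eqxx ?orbT // vp.
    by exists v; rewrite ?inE ?eqxx // eq_sym vp esym.
pose good (q : {set T} * {set T}) := 
  [&& join_pairb e V q.1 q.2, q.2 != set0 & X0 \subset q.1].
have good0 : good (X0, Y0).
  apply/and3P; split=> //; first exact/join_pairP.
  by apply/set0Pn; exists v; rewrite !inE eqxx.
case: (arg_maxnP (fun q => #|q.1 :|: q.2|) good0) => -[X Y].
move=> /and3P[/= /join_pairP join Y0n X0X] qmax.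
have maxXY (X' Y' : {set T}) t : join_pair e V X' Y' -> Y' != set0 -> X \subset X' ->
     X :|: Y \subset X' :|: Y' -> t \in X' :|: Y' -> t \in X :|: Y.
  move=> join' Y'n XX' XYsub; suff /eqP-> : X :|: Y == X' :|: Y' by [].
  rewrite eqEcard XYsub; apply: (qmax (X', Y')).
  by apply/and3P; split=> //; [exact/join_pairP|exact: subset_trans XX'].
have [XV YV cXY aX nY] := join.
have kX : k \in X by apply: (subsetP X0X); rewrite !inE eqxx.
have k'X : k' \in X by apply: (subsetP X0X); rewrite !inE eqxx orbT.
have sX : s \in X by apply: (subsetP X0X); rewrite !inE eqxx orbT.
have XnY z : z \in X -> z \notin Y.
  by move=> zX; apply/negP => zY; move: (cXY _ _ zX zY); rewrite eirr.
pose C := [set c in V :\: (X :|: Y) | [forall z in X :|: Y, e c z]].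
have inC c : c \in C -> [/\ c \in V, c \notin X, c \notin Y & {in X :|: Y, forall z, e c z}].
  rewrite inE in_setD in_setU negb_or => /andP[/andP[/andP[-> ->] ->] /forall_inP].
  by split.
pose E := [set z | connect (restr e X) k z].
have kE : k \in E by rewrite inE connect0.
have EX z : z \in E -> z \in X by rewrite inE => /connect_restr_mem; apply.
have EE x z : x \in E -> z \in X -> e x z -> z \in E.
  move=> xE zX exz; move: (xE); rewrite !inE => /connect_trans; apply.
  by apply: connect1; rewrite /restr /= EX // zX.
have k'E : k' \in E by apply: EE ekk'.
(* [D] also contains the vertices of [X] outside [E]. *)
pose D := V :\: (E :|: C :|: Y).
have inD z : (z \in D) = [&& z \in V, z \notin E, z \notin C & z \notin Y].
  rewrite in_setD !in_setU !negb_or; case: (z \in V); rewrite ?andbF //.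
  by rewrite !andbT -andbA.
pose O := [set o in D :|: Y | [exists y in Y, connect (restr e (D :|: Y)) o y]].
have YO z : z \in Y -> z \in O.
  by move=> zY; rewrite inE in_setU zY orbT; apply/exists_inP; exists z.
have inO z : z \in O -> [/\ z \in V, z \notin E & z \notin C].
  rewrite inE in_setU => /andP[/orP[zD|zY] _].
    by move: zD; rewrite inD => /and4P[].
  split; first exact: (subsetP YV).
    by apply: contraL zY => /EX /XnY.
  by apply: contraL zY => /inC[].
have OO a o : a \in D -> o \in O -> e a o -> a \in O.
  rewrite [o \in O]inE [a \in O]inE => aD /andP[oDY /exists_inP[y yY oy]] eao.
  rewrite in_setU aD; apply/exists_inP; exists y => //; apply: connect_trans oy.
  by apply: connect1; rewrite /restr /= oDY in_setU aD.
have cEY : complete e E Y by move=> x y /EX; apply: cXY.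
(* A vertex of [D] seeing [E] is outside [X], since [E] is a component of [X]. If it also saw [Y],
   it would be in [C] by [join_attachment]. *)
have EDY x d y : x \in E -> d \in D -> y \in Y -> e d x -> ~~ e d y.
  move=> xE; rewrite inD => /and4P[dV dE dC dY] yY edx; apply/negP => edy.
  have dX : d \notin X by apply: contra dE => dX; apply: EE xE dX _; rewrite esym.
  case/negP: dC; rewrite inE in_setD in_setU (negPf dX) (negPf dY) dV /=.
  apply/forall_inP; apply: (join_attachment esym eirr capF join maxXY dV) edx edy => //.
    by rewrite inE negb_or dX.
  exact: EX.
have Opath o : o \in O -> o \in D -> exists q y,
    [/\ y \in Y, path e o (rcons q y) & {subset q <= D}].
  rewrite inE => /andP[_ /exists_inP[y yY /connectP[q pth yE]]].
  elim: q o pth yE => [|z q IHq] o /=.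
    by move=> _ yo; rewrite inD -yo yY /= !andbF.
  move=> /andP[/and3P[_ zDY eoz] pth] yl oD.
  have [zY|zY] := boolP (z \in Y); first by exists [::], z; split; rewrite //= eoz.
  have zD : z \in D by move: zDY; rewrite inE (negPf zY) orbF.
  have [r [y' [y'Y pthr rD]]] := IHq z pth yl zD.
  exists (z :: r), y'; split=> //=; first by rewrite eoz.
  by move=> t; rewrite inE => /orP[/eqP->|/rD].
(* By [homogeneous], adjacency to [o] spreads along the edges of the connected set [E]. *)
have Ohom o x : o \in O -> x \in E -> e o x -> {in E, forall x', e o x'}.
  move=> oO xE eox x' x'E; have [oY|onY] := boolP (o \in Y).
    by rewrite esym; apply: cEY.
  have oD : o \in D by move: (oO); rewrite inE in_setU (negPf onY) orbF => /andP[].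
  have [q [y [yY pth qD]]] := Opath o oO oD.
  suff /andP[] : [pred z | (z \in E) && e o z] x' by [].
  have xx' : connect (restr e X) x x'.
    apply: (connect_trans (y := k)); last by rewrite inE in x'E.
    by rewrite connect_restr_sym //; rewrite inE in xE.
  apply: (connect_inv xx'); last by rewrite /= xE.
  move=> a b /and3P[_ bX eab] /andP[aE eoa]; have bE := EE _ _ aE bX eab.
  apply/andP; split=> //.
  exact: (homogeneous esym eirr capF cEY EDY oD yY pth qD aE bE eab eoa).
(* [y] is the marker for [B2]. Its non-neighbour [y'] will lie outside [V1], as [k'] outside [V2],
   so that both parts are proper. *)
have [y yY] := set0Pn _ Y0n; have [y' y'Y /andP[yy' nyy']] := nY _ yY.
pose A1 := D :\: O; pose B2 := [set o in O | [forall x in E, e o x]]; pose A2 := O :\: B2.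
have BA o : (o \in B2) || (o \in A2) = (o \in O).
  by rewrite in_setD [o \in B2]inE; case: (o \in O) => //=; case: [forall _ in _, _].
have A2E o x : o \in A2 -> x \in E -> ~~ e o x.
  rewrite inE [o \in B2]inE => /andP[nB oO] xE; apply: contra nB => eox.
  by rewrite oO; apply/forall_inP; apply: Ohom eox.
have A1O a o : a \in A1 -> o \in O -> ~~ e a o.
  by rewrite inE => /andP[aO aD] oO; apply: contra aO; apply: OO.
have B2O o : o \in B2 -> o \in O by rewrite inE => /andP[].
have A2O o : o \in A2 -> o \in O by rewrite inE => /andP[].
have yO := YO _ yY; have y'O := YO _ y'Y.
have yB2 : y \in B2.
  by rewrite inE yO; apply/forall_inP => x xE; rewrite esym; apply: cEY.
pose V1 := y |: (E :|: A1 :|: C); pose V2 := k |: (B2 :|: A2 :|: C).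
have inV1 z : (z \in V1) = [|| z == y, z \in E, z \in A1 | z \in C].
  by rewrite in_setU1 !in_setU -!orbA.
have inV2 z : (z \in V2) = [|| z == k, z \in O | z \in C].
  by rewrite in_setU1 !in_setU BA.
have OnV1 z : z \in O -> z != y -> z \notin V1.
  move=> zO zy; have [_ zE zC] := inO _ zO.
  by rewrite inV1 !negb_or zy zE zC in_setD zO.
have k'V2 : k' \notin V2.
  rewrite inV2 !negb_or eq_sym kk' /=; apply/andP; split.
    by apply: contraL k'E => /inO[].
  by apply/negP => /inC[_]; rewrite k'X.
have V1V : V1 \subset V.
  apply/subsetP => z; rewrite inV1 => /or4P[/eqP->|/EX|zA|/inC[]//].
  - exact: (subsetP YV).
  - exact: (subsetP XV).
  - by move: zA; rewrite in_setD inD => /and3P[].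
have V2V : V2 \subset V.
  by apply/subsetP => z; rewrite inV2 => /or3P[/eqP->//|/inO[]//|/inC[]].
exists V1, V2; split.
- apply/properP; split=> //; exists y'; first exact: (subsetP YV).
  by apply: OnV1; rewrite // eq_sym.
- by apply/properP; split=> //; exists k'.
- have V12 z : z \in V1 :&: V2 -> [|| z == y, z == k | z \in C].
    rewrite inE inV1 inV2 => /andP[+ /or3P[->|zO|->]]; rewrite ?orbT //.
    move: (inO _ zO) => [_ /negPf-> /negPf->] /or4P[->//|//|zA|//].
    by rewrite in_setD zO in zA.
  have yk : e y k by rewrite esym; apply: cEY.
  have Ck c : c \in C -> e c k by move=> /inC[_ _ _]; apply; rewrite inE kX.
  have Cy c : c \in C -> e c y by move=> /inC[_ _ _]; apply; rewrite inE yY orbT.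
  move=> z t /V12/or3P[/eqP->|/eqP->|zC] /V12/or3P[/eqP->|/eqP->|tC] //; rewrite ?eqxx // => zt.
  + by rewrite esym Cy.
  + by rewrite esym.
  + by rewrite esym Ck.
  + exact: Cy.
  + exact: Ck.
  + have [zV _ _ zU] := inC _ zC; have [tV _ _ tU] := inC _ tC.
    exact: (join_universal_clique esym eirr join maxXY).
- move=> n1 n2 sep1 sep2.
  apply: (@separable_amalgam _ e esym eirr V E A1 C B2 A2 k y) => //.
  + apply/subsetP => z zV; rewrite 4!in_setU BA -!orbA.
    have [//|zE] := boolP (z \in E); have [|zC] := boolP (z \in C); first by rewrite !orbT.
    have [|zO] := boolP (z \in O); first by rewrite !orbT.
    rewrite in_setD zO inD zV zE zC /=.
    by case: (boolP (z \in Y)) zO => // /YO ->.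
  + rewrite -setI_eq0; apply/eqP/setP => z; rewrite !in_setI in_set0.
    by apply/negP => /andP[zE /A2O/inO[_]]; rewrite zE.
  + rewrite -setI_eq0; apply/eqP/setP => z; rewrite !in_setI in_set0.
    by apply/negP => /andP[zA /B2O zO]; rewrite in_setD zO in zA.
  + move=> c c' cC c'C cc'.
    have [cV _ _ cU] := inC _ cC; have [c'V _ _ c'U] := inC _ c'C.
    exact: (join_universal_clique esym eirr join maxXY).
  + move=> x c xE /inC[_ _ _ cU]; rewrite esym cU // inE EX //.
  + by move=> c /inC[_ _ _ cU]; rewrite cU // inE yY orbT.
  + by move=> x o xE; rewrite inE => /andP[_ /forall_inP oE]; rewrite esym oE.
  + by move=> x o xE oA; rewrite esym A2E.
  + by move=> a o aA /B2O; apply: A1O.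
  + by move=> a o aA /A2O; apply: A1O.
(* A vertex [w] of [X] outside [E] lies in [O], being adjacent to [y]; then [k'] and [w] form a
   nonadjacent pair contained in neither part. Otherwise [s] is in [E], and [V1] keeps the pair [k],
   [s] while [V2] keeps [y], [y']. *)
- have [XE|/subsetPn[w wX wE]] := boolP (X \subset E).
    right; split=> cl.
      have kV1 : k \in V1 by rewrite inV1 kE orbT.
      have sV1 : s \in V1 by rewrite inV1 (subsetP XE) ?orbT.
      by move: nsk; rewrite cl.
    have yV2 : y \in V2 by rewrite inV2 yO orbT.
    have y'V2 : y' \in V2 by rewrite inV2 y'O orbT.
    by move: nyy'; rewrite cl.
  left; exists k', w; split.
  + by rewrite in_setD k'V2.
  + rewrite in_setD (subsetP XV) // andbT; apply: OnV1; last first.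
      by apply: contraTneq wX => ->; apply: contraL yY => /XnY.
    apply: (OO w y) => //; last exact: cXY.
    rewrite inD (subsetP XV) // wE XnY // andbT /=.
    by apply/negP => /inC[_]; rewrite wX.
  + by apply: contraNneq wE => <-.
  + by apply: contra wE; apply: EE.
Qed.

(** * Counting nonadjacent pairs *)

Definition nonadjacent V :=
  [set u : T * T | [&& u.1 \in V, u.2 \in V, u.1 != u.2 & ~~ e u.1 u.2]].

Lemma nonadjacent_eq0 V : nonadjacent V = set0 -> clique e V.
Proof.
move=> /setP V0 x y xV yV xy; move: (V0 (x, y)); rewrite !inE xV yV xy /=.
by move/negPn.
Qed.

Lemma nonadjacent_gt0 V : ~ clique e V -> 0 < #|nonadjacent V|.
Proof. by rewrite card_gt0 => ncl; apply/eqP => /nonadjacent_eq0. Qed.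

(** A nonadjacent pair counted in both parts would lie in the clique that they share. *)
Lemma nonadjacentD V V1 V2 : V1 \subset V -> V2 \subset V -> clique e (V1 :&: V2) ->
  #|nonadjacent V1| + #|nonadjacent V2| <= #|nonadjacent V|.
Proof.
move=> V1V V2V cl; rewrite -cardsUI [_ :&: _](_ : _ = set0).
  rewrite cards0 addn0; apply/subset_leq_card/subsetP => -[u w]; rewrite !inE /=.
  by case/orP=> [/and4P[/(subsetP V1V)-> /(subsetP V1V)-> -> ->]|/and4P[/(subsetP V2V)-> /(subsetP V2V)-> -> ->]].
apply/setP => -[u w]; rewrite !inE /=; apply/negP.
move=> /andP[/and4P[u1 w1 uw nuw] /and4P[u2 w2 _ _]].
by move: nuw; rewrite cl // inE ?u1 ?w1.
Qed.

Lemma nonadjacentD_lt V V1 V2 u w : V1 \subset V -> V2 \subset V ->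
    clique e (V1 :&: V2) -> u \in V :\: V2 -> w \in V :\: V1 -> u != w -> ~~ e u w ->
  #|nonadjacent V1| + #|nonadjacent V2| < #|nonadjacent V|.
Proof.
move=> V1V V2V cl; rewrite !inE => /andP[u2 uV] /andP[w1 wV] uw nuw.
rewrite -cardsUI [_ :&: _](_ : _ = set0).
  rewrite cards0 addn0; apply: proper_card; apply/properP; split.
    apply/subsetP => -[a b]; rewrite !inE /=.
    by case/orP=> [/and4P[/(subsetP V1V)-> /(subsetP V1V)-> -> ->]|/and4P[/(subsetP V2V)-> /(subsetP V2V)-> -> ->]].
  exists (u, w); first by rewrite !inE uV wV uw nuw.
  by rewrite !inE /= (negPf u2) (negPf w1) !andbF.
apply/setP => -[a b]; rewrite !inE /=; apply/negP.
move=> /andP[/and4P[a1 b1 ab nab] /and4P[a2 b2 _ _]].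
by move: nab; rewrite cl // inE ?a1 ?b1.
Qed.

End CapFree.

(** * The induction and the final bound *)

Lemma separable_leq (T : finType) (e : rel T) (V : {set T}) m n :
  separable e V m -> m <= n -> separable e V n.
Proof. by move=> [F sepF leF] lemn; exists F => //; apply: leq_trans lemn. Qed.

(* Superadditive on positive arguments, and with slack 1 as soon as a pair of
   nonadjacent vertices is lost, even if a part is a clique. *)
Definition weight (m : nat) : nat := maxn 1 (4 * m).-1.

Lemma weight_lt a b c : a + b < c -> (weight a + weight b).+1 <= weight c.
Proof. rewrite /weight; lia. Qed.

Lemma weight_le a b c : 0 < a -> 0 < b -> a + b <= c ->
  weight a + weight b <= weight c.
Proof. rewrite /weight; lia. Qed.

Section CapFree.

Variables (T : finType) (e : rel T).
Hypotheses (esym : symmetric e) (eirr : irreflexive e) (capF : cap_free e).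

(** Induction on the size of [V]. An amalgam needs no further cut. A split along a component adds at
    most [3 * #|T| ^ 2] cuts, paid for by the slack of [weight]. *)
Lemma separable_nonadjacent (V : {set T}) : 0 < #|T| ->
  separable e V (3 * #|T| ^ 2 * weight #|nonadjacent e V|).
Proof.
move=> T0; have [n] := ubnP #|V|; elim: n V => // n IHn V; rewrite ltnS => leV.
have IHproper (V' : {set T}) : V' \proper V ->
    separable e V' (3 * #|T| ^ 2 * weight #|nonadjacent e V'|).
  by move=> /proper_card ltV; apply: IHn; apply: leq_trans ltV _.
have sqT : #|T| <= #|T| * #|T| by rewrite leq_pmulr.
have [V0|Vn] := eqVneq (nonadjacent e V) set0.
  apply: separable_leq (separable_clique (nonadjacent_eq0 V0)) _.
  have leVT : #|V| <= #|T| := max_card _.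
  rewrite V0 cards0 /weight muln1 -mulnn; clear -leVT sqT T0.
  by move: leVT sqT T0; set N := #|T|; set M := N * N; lia.
have ncl : ~ clique e V.
  move=> cl; case/set0Pn: Vn => -[u w]; rewrite !inE /= => /and4P[uV wV uw].
  by rewrite cl.
have [L [B [Q [[VE dL /set0Pn[l lL] /set0Pn[q qQ]] [cLB aLQ connQ BQ]]]]] :=
  exists_full_component esym ncl.
have inV z : (z \in V) = (z \in L) || (z \in B :|: Q) by rewrite {1}VE inE.
pose config (u : T * T * T * T * T) := let: (v, p, k, k', s) := u in
  [&& v \in L, p \in Q, k \in B, k' \in B & s \in B] &&
  [&& e k k', ~~ e s k, ~~ e s k', e p k, e p k' & e p s].
have [/existsP[[[[[v p] k] k'] s]]|/existsPn noconfig] := boolP [exists u, config u].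
  move=> /andP[/and5P[vL pQ kB k'B sB] /and5P[ekk' nsk nsk' epk /andP[epk' eps]]].
  have [|||||||||||V1 [V2 [V1V V2V cl sep alt]]] :=
    @exists_amalgam _ e esym eirr capF V v p k k' s.
  1-5: by rewrite inV ?vL // inE ?pQ ?kB ?k'B ?sB ?orbT.
  - by apply: contraTneq pQ => <-; have := disjointFr dL vL; rewrite inE => /norP[].
  - exact: aLQ.
  - by [].
  - by [].
  - by [].
  - move=> z; rewrite !inE => /orP[]/eqP-> //; split; exact: cLB.
  apply: separable_leq (sep _ _ (IHproper _ V1V) (IHproper _ V2V)) _.
  rewrite -mulnDr leq_mul2l; apply/orP; right.
  have [V1s V2s] := (proper_sub V1V, proper_sub V2V).
  (* In the first case a part may be a clique, which still has weight 1, and the lost pair makes up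
     for it. In the second case both counts are positive. *)
  case: alt => [[u [w [uV wV uw nuw]]]|[/nonadjacent_gt0 n1 /nonadjacent_gt0 n2]].
    by apply/ltnW/weight_lt/nonadjacentD_lt/nuw.
  exact/weight_le/nonadjacentD.
have LV : L \subset V by apply/subsetP => z zL; rewrite inV zL.
have BQV : B :|: Q \subset V by apply/subsetP => z zL; rewrite inV zL orbT.
have lBQ : l \notin B :|: Q by rewrite (disjointFr dL lL).
have qBQ : q \in B :|: Q by rewrite inE qQ orbT.
have qnL : q \notin L by rewrite (disjointFl dL qBQ).
have lV : l \in V by rewrite inV lL.
have qV : q \in V by rewrite inV qBQ orbT.
have sepL : L \proper V by apply/properP; split=> //; exists q.
have sepBQ : B :|: Q \proper V by apply/properP; split=> //; exists l.
have VL : V \subset L :|: (B :|: Q) by rewrite -VE.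
apply: separable_leq (separable_components esym eirr capF VL cLB aLQ connQ BQ _
  (IHproper _ sepL) (IHproper _ sepBQ)) _.
  move=> v p k k' s vL pQ kB k'B sB ekk' nsk nsk' epk epk' eps.
  move: (noconfig (v, p, k, k', s)).
  by rewrite /config vL pQ kB k'B sB ekk' nsk nsk' epk epk' eps.
(* The nonadjacent pair [(l, q)] is split between the two parts, which frees one unit of
   [weight]. *)
have lt : #|nonadjacent e L| + #|nonadjacent e (B :|: Q)| < #|nonadjacent e V|.
  apply: (@nonadjacentD_lt _ e V L (B :|: Q) l q) => //.
  - by move=> z t; rewrite inE => /andP[zL zBQ]; rewrite (disjointFr dL zL) in zBQ.
  - by rewrite in_setD lBQ.
  - by rewrite in_setD qnL.
  - by apply: contraTneq lL => ->.
  - exact: aLQ.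
have lt3 : (#|T| + #|T| * #|T|).+1 <= 3 * #|T| ^ 2.
  by rewrite -mulnn; clear -sqT T0; move: sqT T0; set N := #|T|; set M := N * N; lia.
apply: leq_trans (leq_add (leqnn _) lt3) _.
rewrite -mulnDr addnC -mulnS leq_mul2l; apply/orP; right.
exact: weight_lt.
Qed.

End CapFree.

Theorem theorem10 :
  exists A : nat, forall (T : finType) (e : rel T),
    simple_graph e -> 0 < #|T| -> cap_free e ->
    exists2 F : {set {set T} * {set T}},
      CS_separator e F & #|F| <= A * #|T| ^ 5.
Proof.
(* There are at most [#|T| ^ 2] nonadjacent ordered pairs, so [weight] is at most [4 * #|T| ^ 2] and
   [12 * #|T| ^ 4] cuts suffice; the last factor [#|T|] is given away. *)
exists 12 => T e [esym eirr] T0 capF.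
have [F sepF leF] := separable_nonadjacent esym eirr capF setT T0.
exists [set (W, ~: W) | W in F]; last first.
  apply: leq_trans (leq_imset_card _ _) _; apply: leq_trans leF _.
  have : #|nonadjacent e setT| <= #|T| * #|T|.
    by rewrite -card_prod; apply: max_card.
  rewrite -mulnA (_ : 12 = 3 * 4) // -mulnA leq_mul2l /= (_ : 5 = 2 + 3) //.
  rewrite expnD mulnCA leq_mul2l => leN; apply/orP; right.
  apply: leq_trans (_ : 4 * (#|T| * #|T|) <= _); 
    have TT0 : 0 < #|T| * #|T| by rewrite muln_gt0 T0.
    by rewrite /weight; clear -leN TT0; move: leN TT0; set m := #|_|; set M := _ * _; lia.
  by rewrite leq_mul2l /= expnS leq_mul2l expnS expn1 leq_pmulr ?orbT.
split=> [W /imsetP[X _ ->]|K S clK stS KS].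
  by split=> /=; rewrite ?setICr ?setUCr.
have [|W WF /andP[KW SW]] := sepF K S (subsetT _) (subsetT _) clK stS.
  by rewrite -setI_eq0 KS eqxx.
exists (W, ~: W); first exact: imset_f.
by split; rewrite //= -disjoints_subset.
Qed.
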